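(* Let $P$ be a normal logic program and $I$ a three-valued interpretation of $P$. Then $I$ is a regular model of $P$ if and only if $I$ is a $\le_s$-minimal stable trap space of $P$ (i.e., a stable trap space such that no stable trap space $J\neq I$ satisfies $J\le_s I$).
   Context: Fix a first-order language with finitely many constant, function and predicate symbols. A normal logic program (NLP) $P$ is a finite set of rules $p \leftarrow p_1,\dots,p_m, \mathord{\sim} p_{m+1},\dots,\mathord{\sim} p_k$ ($k\ge m\ge 0$). $\mathrm{HB}(P)$ is its Herbrand base (possibly infinite), $\mathrm{gr}(P)$ its ground instantiation; for a ground rule $r$: head $\mathrm{head}(r)$, positive body atoms $B^+(r)$, negative body atoms $B^-(r)$, $\mathrm{bf}(r)=\bigwedge_{v\in B^+(r)}v\wedge\bigwedge_{v\in B^-(r)}\neg v$. A three-valued interpretation is a map $I:\mathrm{HB}(P)\to\{0,1,\star\}$; two-valued ones (no $\star$) are identified with subsets of $\mathrm{HB}(P)$. $[I]=\{J\subseteq\mathrm{HB}(P): \forall a,\ I(a)\ne\star\Rightarrow J(a)=I(a)\}$. Orders on $\{0,1,\star\}$, extended pointwise: $\le_t$ with $0<_t\star<_t1$; $\le_s$ with $0<_s\star$, $1<_s\star$ only. Kleene evaluation: $\neg\star=\star$, conjunction = $\le_t$-min, disjunction = $\le_t$-max. $I$ is a three-valued model of a program if $I(\mathrm{bf}(r))\le_t I(\mathrm{head}(r))$ for each ground rule $r$. The reduct $P^I$ of $P$ w.r.t. three-valued $I$: from $\mathrm{gr}(P)$ delete every rule with some $b\in B^-(r)$, $I(b)=1$;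 delete every occurrence of $\mathord{\sim}b$ with $I(b)=0$; replace each remaining $\mathord{\sim}b$ by a special atom $\mathbf{u}\notin\mathrm{HB}(P)$ that always has value $\star$. $P^I$ has a unique $\le_t$-least three-valued model; $I$ is a stable partial model of $P$ if it equals this least model. A regular model is a $\le_s$-minimal stable partial model. For two-valued $I$, $F_P(I)$ is the $\subseteq$-least model of the Gelfond–Lifschitz reduct (delete rules with some $b\in B^-(r)\cap I$, then delete remaining negative literals). A nonempty set $S$ of two-valued interpretations is a stable trap set if $\{F_P(J):J\in S\}\subseteq S$; a three-valued $I$ is a stable trap space if $[I]$ is a stable trap set. *)

(* Defs.v *)
From HB Require Import structures.
From mathcomp Require Import all_boot.
From mathcomp Require Import boolp classical_sets functions cardinality.

Set Implicit Arguments.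
Unset Strict Implicit.
Unset Printing Implicit Defensive.

Local Open Scope classical_set_scope.

(* Constants are the function symbols of arity 0. *)
Record language := Language {
  func : finType;
  func_arity : func -> nat;
  pred_sym : finType;
  pred_arity : pred_sym -> nat }.

Inductive term (L : language) (V : Type) :=
| Var of V
| App (f : func L) of {ffun 'I_(func_arity f) -> term L V}.

Inductive atom (L : language) (V : Type) :=
| Atom (p : pred_sym L) of {ffun 'I_(pred_arity p) -> term L V}.

HB.instance Definition _ (L : language) (V : Type) := gen_eqMixin (atom L V).

Fixpoint subst_term (L : language) (V W : Type) (s : V -> term L W)
    (t : term L V) : term L W :=
  match t with
  | Var x => s x
  | App f ts => App [ffun i => subst_term s (ts i)]
  end.

Definition subst_atom (L : language) (V W : Type) (s : V -> term L W)
    (a : atom L V) : atom L W :=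
  let: Atom p ts := a in Atom [ffun i => subst_term s (ts i)].

(* Ground atoms are the atoms over the empty type of variables. *)
Definition herbrand_base (L : language) : Type := atom L void.

HB.instance Definition _ (L : language) := Equality.on (herbrand_base L).

Record nrule (A : Type) := NRule {
  head : A;
  bpos : seq A;
  bneg : seq A }.

Definition map_rule (A B : Type) (f : A -> B) (r : nrule A) : nrule B :=
  NRule (f (head r)) (map f (bpos r)) (map f (bneg r)).

(* The variables are the natural numbers. *)
Record nlp (L : language) := NLP {
  rules : set (nrule (atom L nat));
  finite_rules : finite_set rules }.

Definition ground_atom (L : language) : herbrand_base L -> atom L nat :=
  subst_atom (fun x : void => match x with end).

(* The instances of rules of P in which no variable occurs. Quantifying over
   substitutions with possibly nonground values, rather than over maps
   nat -> term L void, keeps the variable-free rules of P in gr(P) when L has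
   no constant symbol. *)
Definition gr (L : language) (P : nlp L) : set (nrule (herbrand_base L)) :=
  [set g | exists2 r, rules P r &
     exists s : nat -> term L nat,
       map_rule (subst_atom s) r = map_rule (@ground_atom L) g].

Inductive tv := T0 | Tstar | T1.

Definition let_tv (x y : tv) : bool :=
  match x, y with
  | T0, _ | Tstar, Tstar | Tstar, T1 | T1, T1 => true
  | _, _ => false
  end.

Definition les_tv (x y : tv) : Prop := x = y \/ y = Tstar.

Definition neg_tv (x : tv) : tv :=
  match x with T0 => T1 | Tstar => Tstar | T1 => T0 end.

Definition and_tv (x y : tv) : tv := if let_tv x y then x else y.

Definition let_interp (A : Type) (I J : A -> tv) : Prop :=
  forall a, let_tv (I a) (J a).

Definition les_interp (A : Type) (I J : A -> tv) : Prop :=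
  forall a, les_tv (I a) (J a).

Definition eval_body (A : Type) (I : A -> tv) (r : nrule A) : tv :=
  foldr and_tv T1 (map I (bpos r) ++ map (neg_tv \o I) (bneg r)).

Definition model3 (A : Type) (Q : set (nrule A)) (I : A -> tv) : Prop :=
  forall r, Q r -> let_tv (eval_body I r) (I (head r)).

(* Programs with the special atom u are programs over [option A], where u is
   [None]; an interpretation of A is extended with the value star at u. *)
Definition extend_u (A : Type) (I : A -> tv) : option A -> tv := oapp I Tstar.

Definition reduct_rule (A : Type) (I : A -> tv) (r : nrule A) :
    nrule (option A) :=
  NRule (Some (head r))
    (map Some (bpos r) ++
     [seq None | b <- bneg r & if I b is T0 then false else true])
    [::].

Section Semantics.
Variables (L : language) (P : nlp L).
Local Notation hb := (herbrand_base L).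

Definition reduct (I : hb -> tv) : set (nrule (option hb)) :=
  [set reduct_rule I r | r in
     [set r | gr P r /\ forall b, b \in bneg r -> I b <> T1]].

Definition least_model3 (Q : set (nrule (option hb))) (M : hb -> tv) : Prop :=
  model3 Q (extend_u M) /\
  forall N : hb -> tv, model3 Q (extend_u N) -> let_interp M N.

Lemma least_model3_unique (Q : set (nrule (option hb))) (M N : hb -> tv) :
  least_model3 Q M -> least_model3 Q N -> M = N.
Proof.
move=> [mM leM] [mN leN]; apply: funext => a.
by move: (leM _ mN a) (leN _ mM a); case: (M a); case: (N a).
Qed.

Definition stable_partial_model (I : hb -> tv) : Prop :=
  least_model3 (reduct I) I.

Definition minimal_s (C : set (hb -> tv)) (I : hb -> tv) : Prop :=
  C I /\ forall J, C J -> les_interp J I -> J = I.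

Definition regular_model : (hb -> tv) -> Prop :=
  minimal_s stable_partial_model.

Definition model2 (Q : set (nrule hb)) (J : set hb) : Prop :=
  forall r, Q r ->
    (forall v, v \in bpos r -> J v) -> (forall v, v \in bneg r -> ~ J v) ->
    J (head r).

Definition gl_reduct (J : set hb) : set (nrule hb) :=
  [set NRule (head r) (bpos r) [::] | r in
     [set r | gr P r /\ forall b, b \in bneg r -> ~ J b]].

Definition F_P (J : set hb) : set hb :=
  \bigcap_(M in [set M | model2 (gl_reduct J) M]) M.

Lemma F_P_least (J : set hb) :
  model2 (gl_reduct J) (F_P J) /\
  forall M, model2 (gl_reduct J) M -> F_P J `<=` M.
Proof.
split=> [r Qr posr negr | M MJ a FPa]; last by apply: FPa.
move=> M MJ; apply: (MJ r) => // [v /posr FPv | v]; first exact: FPv.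
by case: Qr => r' _ <-; rewrite in_nil.
Qed.

Definition two_valued (I : hb -> tv) : set (set hb) :=
  [set J | forall a, (I a = T1 -> J a) /\ (I a = T0 -> ~ J a)].

Definition stable_trap_set (S : set (set hb)) : Prop :=
  S !=set0 /\ F_P @` S `<=` S.

Definition stable_trap_space (I : hb -> tv) : Prop :=
  stable_trap_set (two_valued I).

End Semantics.

(* Main.v *)
(* Encode a three-valued I by the pair (L, U) of its true and its possible
   (non-false) atoms, L included in U.  Then I is a stable partial model iff
   L = F_P U and U = F_P L, and, F_P being antitone, it is a stable trap space
   iff L <= F_P U and F_P L <= U.  Every stable trap space is thus refined by
   a stable partial model (A, F_P A), with A the least set above L closed under
   the monotone operator F_P \o F_P; hence both notions have the same
   minimal elements. *)
Require Import Defs.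
From mathcomp Require Import all_boot.
From mathcomp Require Import boolp classical_sets functions cardinality.

Set Implicit Arguments.
Unset Strict Implicit.
Unset Printing Implicit Defensive.

Local Open Scope classical_set_scope.

(** * Three-valued interpretations as pairs of sets *)

Section Interpretations.
Variable A : Type.
Implicit Types (I J : A -> tv) (X Y : set A).

Definition true_atoms I : set A := [set a | I a = T1].

Definition possible_atoms I : set A := [set a | I a <> T0].

(** Decodes a pair; [X] takes priority, so only recovering [Y] needs [X] inside [Y]. *)
Definition interp_of X Y : A -> tv :=
  fun a => if `[< X a >] then T1 else if `[< Y a >] then Tstar else T0.

Lemma true_possible I : true_atoms I `<=` possible_atoms I.
Proof. by move=> a; rewrite /true_atoms /possible_atoms /= => ->. Qed.

Lemma true_interp_of X Y : true_atoms (interp_of X Y) = X.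
Proof.
apply/seteqP; split=> a; rewrite /true_atoms /interp_of /=.
  by case: asboolP => // _; case: asboolP.
by move=> Xa; rewrite asboolT.
Qed.

Lemma possible_interp_of X Y :
  X `<=` Y -> possible_atoms (interp_of X Y) = Y.
Proof.
move=> XY; apply/seteqP; split=> a; rewrite /possible_atoms /interp_of /=.
  by case: asboolP => [/XY //|_]; case: asboolP.
by move=> Ya; rewrite (asboolT Ya); case: ifP.
Qed.

(** Encoding [T0], [Tstar], [T1] as (0,0), (0,1), (1,1) makes the truth order componentwise. *)
Lemma let_tvP (x y : tv) :
  let_tv x y <-> (x = T1 -> y = T1) /\ (x <> T0 -> y <> T0).
Proof.
by case: x; case: y; split=> //; try (by split); case=> h1 h2;
   [case: h2 | case: h2 | have := h1 erefl].
Qed.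

Lemma let_interpP I J :
  let_interp I J <-> true_atoms I `<=` true_atoms J /\
                     possible_atoms I `<=` possible_atoms J.
Proof.
split=> [IJ|[tIJ pIJ] a]; last by apply/let_tvP; split; [exact: tIJ|exact: pIJ].
by split=> a; have /let_tvP[] := IJ a.
Qed.

(** Resolving stars shrinks the interval of two-valued completions from both ends. *)
Lemma les_interpP I J :
  les_interp J I <-> true_atoms I `<=` true_atoms J /\
                     possible_atoms J `<=` possible_atoms I.
Proof.
split=> [JI|[tIJ pJI] a].
  by split=> a; rewrite /true_atoms /possible_atoms /=; case: (JI a) => ->.
move: (tIJ a) (pJI a); rewrite /true_atoms /possible_atoms /les_tv /=.
by case: (I a); case: (J a) => h1 h2;
  do [by left|by right|by case: h2|by have := h1 erefl].
Qed.

Lemma les_interp_trans J I K :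
  les_interp I J -> les_interp J K -> les_interp I K.
Proof.
move=> IJ JK a; rewrite /les_tv; case: (JK a) => [<-|]; last by right.
exact: IJ.
Qed.

Lemma les_interp_anti I J : les_interp I J -> les_interp J I -> I = J.
Proof.
by move=> IJ JI; apply: funext => a; case: (IJ a) (JI a) => [->|->] // [] ->.
Qed.

End Interpretations.

Lemma foldr_and_tv_eq1 (A : eqType) (I : A -> tv) (s : seq A) :
  foldr and_tv T1 (map I s) = T1 <-> forall a, a \in s -> I a = T1.
Proof.
elim: s => [|a s IHs] //=; split=> [h|h].
  have [Ia Is] : I a = T1 /\ foldr and_tv T1 (map I s) = T1.
    by move: h; case: (I a); case: foldr.
  by move=> b; rewrite in_cons => /orP[/eqP->//|]; exact: IHs.1.
rewrite h ?mem_head // (IHs.2 _) // => b bs.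
by apply: h; rewrite in_cons bs orbT.
Qed.

Lemma foldr_and_tv_neq0 (A : eqType) (I : A -> tv) (s : seq A) :
  foldr and_tv T1 (map I s) <> T0 <-> forall a, a \in s -> I a <> T0.
Proof.
elim: s => [|a s IHs] //=; split=> [h|h].
  have [Ia Is] : I a <> T0 /\ foldr and_tv T1 (map I s) <> T0.
    by move: h; case: (I a); case: foldr.
  by move=> b; rewrite in_cons => /orP[/eqP->//|]; exact: IHs.1.
have Ia : I a <> T0 by apply: h; rewrite mem_head.
have : foldr and_tv T1 (map I s) <> T0.
  by apply/IHs => b bs; apply: h; rewrite in_cons bs orbT.
by move: Ia; case: (I a); case: foldr.
Qed.

(** * Kleene value of a reduct rule's body *)

Section ReductRule.
Variables (A : eqType) (I N : A -> tv) (r : nrule A).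

(** A negative atom that is not false in [I] leaves a copy of u, whose value star keeps the body
    below 1. *)
Lemma eval_reduct_rule_eq1 :
  eval_body (extend_u N) (reduct_rule I r) = T1 <->
  (forall v, v \in bpos r -> N v = T1) /\
  (forall b, b \in bneg r -> ~ possible_atoms I b).
Proof.
rewrite /eval_body /= cats0; split=> [/foldr_and_tv_eq1 h|[pos neg]].
  split=> [v vr|b br Ib].
    by apply: (h (Some v)); rewrite mem_cat map_f.
  suff /h : None \in map Some (bpos r) ++
     [seq None | b <- bneg r & if I b is T0 then false else true] by [].
  rewrite mem_cat; apply/orP; right; apply/mapP; exists b => //.
  rewrite mem_filter br andbT.
  by move: Ib; rewrite /possible_atoms /=; case: (I b).
apply/foldr_and_tv_eq1 => o; rewrite mem_cat => /orP[/mapP[v vr ->]|].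
  exact: pos.
case/mapP=> b; rewrite mem_filter => /andP[Ib br].
by have := neg _ br; rewrite /possible_atoms /=; case: (I b) Ib => // _ [].
Qed.

(** Copies of u are never false, so only the positive atoms can make the body false. *)
Lemma eval_reduct_rule_neq0 :
  eval_body (extend_u N) (reduct_rule I r) <> T0 <->
  (forall v, v \in bpos r -> N v <> T0).
Proof.
rewrite /eval_body /= cats0; split=> [/foldr_and_tv_neq0 h v vr|pos].
  by apply: (h (Some v)); rewrite mem_cat map_f.
apply/foldr_and_tv_neq0 => o; rewrite mem_cat => /orP[/mapP[v vr ->]|].
  exact: pos.
by case/mapP=> b _ ->.
Qed.

End ReductRule.

(** * Stable partial models and trap spaces through [F_P] *)

Section StableSemantics.
Variables (L : language) (P : nlp L).
Local Notation hb := (herbrand_base L).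
Implicit Types (I J N : hb -> tv) (X Y M : set hb).

Lemma model2_gl_reductP X M :
  model2 (gl_reduct P X) M <->
  forall r, gr P r -> (forall b, b \in bneg r -> ~ X b) ->
    (forall v, v \in bpos r -> M v) -> M (Defs.head r).
Proof.
split=> [mM r gr neg pos|mM _ [r [gr neg] <-] /= pos _]; last exact: mM.
by apply: (mM (NRule (Defs.head r) (bpos r) [::])) => //; exists r.
Qed.

(** A larger set deletes more rules, so models of the reduct by [X] are models of the reduct by
    [Y]. *)
Lemma F_P_antitone X Y : X `<=` Y -> F_P P Y `<=` F_P P X.
Proof.
move=> XY; apply: (F_P_least P Y).2; apply/model2_gl_reductP => r gr neg.
have /model2_gl_reductP mX := (F_P_least P X).1.
by apply: mX => // b br /XY; apply: neg.
Qed.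

(** By [let_tvP] each rule imposes two independent conditions: truth propagates through rules free
    of u, possibility through all rules of the reduct. *)
Lemma model3_reductP I N :
  model3 (reduct P I) (extend_u N) <->
  model2 (gl_reduct P (possible_atoms I)) (true_atoms N) /\
  model2 (gl_reduct P (true_atoms I)) (possible_atoms N).
Proof.
split=> [mN|[/model2_gl_reductP mt /model2_gl_reductP mp] _ [r [gr neg] <-]].
  split; apply/model2_gl_reductP => r gr neg pos.
    have Qr : reduct P I (reduct_rule I r).
      by exists r => //; split=> // b br /(@true_possible _ I); apply: neg.
    by have /let_tvP[+ _] := mN _ Qr; apply; apply/eval_reduct_rule_eq1.
  have Qr : reduct P I (reduct_rule I r) by exists r.
  by have /let_tvP[_] := mN _ Qr; apply; apply/eval_reduct_rule_neq0.
apply/let_tvP; split.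
  by move=> /eval_reduct_rule_eq1[pos neg']; apply: mt.
by move=> /eval_reduct_rule_neq0 pos; apply: mp.
Qed.

Lemma stable_partial_modelP I :
  stable_partial_model P I <->
  true_atoms I = F_P P (possible_atoms I) /\
  possible_atoms I = F_P P (true_atoms I).
Proof.
have [mt lt] := F_P_least P (possible_atoms I).
have [mp lp] := F_P_least P (true_atoms I).
split=> [[/model3_reductP[mtI mpI] leI]|[tI pI]].
  (* This inclusion makes the pair of the two least models a genuine interpretation, to be compared
     with [I]. *)
  have FF := F_P_antitone (@true_possible _ I).
  have /leI/let_interpP : model3 (reduct P I)
      (extend_u (interp_of (F_P P (possible_atoms I)) (F_P P (true_atoms I)))).
    by apply/model3_reductP; rewrite true_interp_of possible_interp_of.
  rewrite true_interp_of possible_interp_of // => -[tI pI].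
  by split; apply/seteqP; split=> //; [exact: lt|exact: lp].
split; first by apply/model3_reductP; split; [rewrite tI|rewrite pI].
move=> N /model3_reductP[mtN mpN]; apply/let_interpP.
by split; [rewrite tI; exact: lt|rewrite pI; exact: lp].
Qed.

Lemma two_valuedE I :
  two_valued I =
  [set X | true_atoms I `<=` X /\ X `<=` possible_atoms I].
Proof.
apply/seteqP; split=> X /= => [IX|[tX Xp] a].
  split=> a; first exact: (IX a).1.
  by move=> Xa I0; have := (IX a).2 I0.
by split; [exact: tX|move=> I0 /Xp].
Qed.

(** An antitone map sends an interval into the one spanned by the swapped images of its endpoints,
    so testing the endpoints suffices. *)
Lemma stable_trap_spaceP I :
  stable_trap_space P I <->
  true_atoms I `<=` F_P P (possible_atoms I) /\
  F_P P (true_atoms I) `<=` possible_atoms I.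
Proof.
rewrite /stable_trap_space /stable_trap_set two_valuedE.
have tp := @true_possible _ I; split=> [[_ trap]|[tF Fp]].
  split.
    by have [] := trap _ (imageP (F_P P) (conj tp (@subset_refl _ _))).
  by have [] := trap _ (imageP (F_P P) (conj (@subset_refl _ _) tp)).
split; first by exists (true_atoms I); split.
move=> _ [X [tX Xp] <-]; split.
  exact: subset_trans tF (F_P_antitone Xp).
exact: subset_trans (F_P_antitone tX) Fp.
Qed.

Lemma stable_partial_model_trap I :
  stable_partial_model P I -> stable_trap_space P I.
Proof.
by move=> /stable_partial_modelP[tI pI]; apply/stable_trap_spaceP; split;
   [rewrite tI|rewrite pI].
Qed.

Lemma stable_trap_space_refine I :
  stable_trap_space P I ->
  exists2 J, stable_partial_model P J & les_interp J I.
Proof.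
move=> /stable_trap_spaceP[]; set T := true_atoms I; set U := possible_atoms I.
move=> TF FU; have TU : T `<=` U := @true_possible _ I.
pose G X := F_P P (F_P P X).
have G_mono X Y : X `<=` Y -> G X `<=` G Y.
  by move=> XY; do 2! apply: F_P_antitone.
pose closed X := T `<=` X /\ G X `<=` X.
pose A := \bigcap_(X in closed) X.
have A_least X : closed X -> A `<=` X by move=> cX a; apply.
have TA : T `<=` A by move=> a Ta X [TX _]; apply: TX.
have GA : G A `<=` A.
  move=> a GAa X cX; apply: cX.2; apply: (G_mono A) GAa.
  exact: A_least.
(* Needed for [G A] to be closed, whence [A] lies inside [G A] by leastness, as in
   Knaster-Tarski. *)
have TG : T `<=` G A.
  apply: subset_trans TF _; apply: F_P_antitone.
  exact: subset_trans (F_P_antitone TA) FU.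
have AE : G A = A.
  by apply/seteqP; split=> //; apply: A_least; split=> //; exact: G_mono.
(* [U] is closed: [TF] gives [G U] inside [F_P P T], which lies in [U]. *)
have AU : A `<=` U.
  apply: A_least; split=> //; apply: subset_trans FU.
  exact: F_P_antitone.
(* [F_P P A] is closed too, being itself fixed by [G] since [G A = A]. *)
have AF : A `<=` F_P P A.
  apply: A_least; split; first exact: subset_trans TF (F_P_antitone AU).
  by rewrite /G -/(G A) AE.
exists (interp_of A (F_P P A)).
  by apply/stable_partial_modelP; rewrite true_interp_of possible_interp_of.
apply/les_interpP; rewrite true_interp_of possible_interp_of //.
by split=> //; exact: subset_trans (F_P_antitone TA) FU.
Qed.

End StableSemantics.

Theorem theorem4p9 (L : language) (P : nlp L) (I : herbrand_base L -> tv) :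
  regular_model P I <-> minimal_s (stable_trap_space P) I.
Proof.
split=> -[CI minI].
  split=> [|J trapJ JI]; first exact: stable_partial_model_trap.
  (* Minimality among stable partial models applies to [K], not to [J]; then [K = I] squeezes [J]
     onto [I]. *)
  have [K stK KJ] := stable_trap_space_refine trapJ.
  have KI := minI _ stK (les_interp_trans KJ JI).
  by apply: les_interp_anti => //; rewrite -KI.
split=> [|J stJ]; last exact/minI/stable_partial_model_trap.
(* [K] is itself a trap space below [I], so minimality gives [K = I] and [I] is stable. *)
have [K stK KI] := stable_trap_space_refine CI.
by rewrite -(minI _ (stable_partial_model_trap stK) KI).
Qed.
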